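(* Let $M$ be a connected Riemann surface and let $\varphi:M\to G_2(\mathbb{C}^5)$ be a harmonic map of finite uniton number which is $\partial'$-irreducible and $\partial''$-irreducible. Then $G'(\varphi)$ is $\partial'$-reducible.
   Context: $M$ is a connected Riemann surface (not necessarily compact), $z$ a local complex coordinate, $\partial_z,\partial_{\bar z}$ the ordinary (flat) derivatives in $\mathbb{C}^n$. A smooth map $\varphi:M\to G_k(\mathbb{C}^n)$ is identified with the rank-$k$ subbundle of $M\times\mathbb{C}^n$ with fibre $\varphi(z)$ at $z$. $\pi_\psi$ is orthogonal projection onto $\psi$, $\psi^\perp$ the orthogonal complement, $\Gamma(\cdot)$ the smooth sections. $A'_\varphi=\pi_{\varphi^\perp}\circ\partial_z|_\varphi$, $A''_\varphi=\pi_{\varphi^\perp}\circ\partial_{\bar z}|_\varphi$. For $\varphi$ harmonic, $G'(\varphi)=\operatorname{Im}A'_\varphi$ and $G''(\varphi)=\operatorname{Im}A''_\varphi$ (extended to subbundles across the isolated points where the rank drops); these are again harmonic. A harmonic map $\varphi$ is $\partial'$-irreducible (resp. $\partial''$-irreducible) if $\operatorname{rank}G'(\varphi)=\operatorname{rank}\varphi$ (resp. $\operatorname{rank}G''(\varphi)=\operatorname{rank}\varphi$); otherwise it is $\partial'$-reducible (resp. $\partial''$-reducible). Finite uniton number: for smooth $\varphi:M\to U(n)$ put $A^\varphi_z=\frac12\varphi^{-1}\partial_z\varphi$, $A^\varphi_{\bar z}=\frac12\varphi^{-1}\partial_{\bar z}\varphi$. A uniton for a harmonic $\varphi:M\to U(n)$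 is a subbundle $\alpha$ of $M\times\mathbb{C}^n$ with $\Gamma(\alpha)$ closed under $\partial_{\bar z}+A^\varphi_{\bar z}$ and under $A^\varphi_z$. $\varphi$ is of finite uniton number if $\varphi=\varphi_0(\pi_{\alpha_1}-\pi_{\alpha_1}^\perp)\cdots(\pi_{\alpha_s}-\pi_{\alpha_s}^\perp)$ for some $s\ge0$, with $\varphi_0\in U(n)$ constant and each $\alpha_i$ a uniton for the partial product of the first $i-1$ factors (times $\varphi_0$). A map $\varphi:M\to G_k(\mathbb{C}^n)$ is of finite uniton number if $\pi_\varphi-\pi_\varphi^\perp:M\to U(n)$ is. *)

(* Defs.v *)
From HB Require Import structures.
From mathcomp Require Import all_boot all_order all_algebra.
From mathcomp Require Import complex.
From mathcomp Require Import all_classical all_reals all_analysis.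
Set Implicit Arguments.
Unset Strict Implicit.
Unset Printing Implicit Defensive.
Import Order.TTheory GRing.Theory Num.Theory.
Import numFieldNormedType.Exports.
Local Open Scope classical_set_scope.
Local Open Scope ring_scope.
Local Open Scope complex_scope.
Local Open Scope sesquilinear_scope.

(* [param] is the inverse of [zcoord] on the image of [dom]; its other values
   are irrelevant (see [is_chart]). *)
Record chart (R : realType) (M : topologicalType) := Chart {
  dom : set M;
  zcoord : M -> (R[i] : numFieldType);
  param : (R[i] : numFieldType) -> M }.

Section RiemannSurface.
Variables (R : realType) (M : topologicalType).
Local Notation C := (R[i] : numFieldType).
Implicit Types (e : chart R M) (A : set (chart R M)).

Definition zcoord_image e : set C := zcoord e @` dom e.

Definition is_chart e : Prop :=
  [/\ open (dom e), open (zcoord_image e),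
      forall x, dom e x -> param e (zcoord e x) = x,
      {in dom e, continuous (zcoord e)} &
      {in zcoord_image e, continuous (param e)}].

Definition holomorphic_transition e1 e2 : Prop :=
  forall x, dom e1 x -> dom e2 x ->
    derivable (zcoord e2 \o param e1 : C -> C) (zcoord e1 x) 1.

(* Second countability is not required: it is automatic for a connected
   Riemann surface (Rado). *)
Definition connected_riemann_surface A : Prop :=
  [/\ hausdorff_space M,
      [set: M] !=set0 /\ connected [set: M],
      (forall e, A e -> is_chart e),
      (forall x, exists2 e, A e & dom e x) &
      (forall e1 e2, A e1 -> A e2 -> holomorphic_transition e1 e2)].

(* The coordinate z = x + iy is read as the point (x, y) of R * R when real
   partial derivatives are taken. *)
Definition cpoint (p : R * R) : C := p.1 +i* p.2.
Definition rpoint (z : C) : R * R := (complex.Re z, complex.Im z).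

Fixpoint Ck (U : set (R * R)) (k : nat) (g : R * R -> R) : Prop :=
  if k is k'.+1 then
    [/\ forall p, U p -> derivable g p (1, 0) /\ derivable g p (0, 1),
        Ck U k' ('D_(1, 0) g) & Ck U k' ('D_(0, 1) g)]
  else {in U, continuous g}.

Definition Cinfty (U : set (R * R)) (g : R * R -> R) : Prop :=
  forall k, Ck U k g.

Section Derivatives.
Variables m n : nat.
Implicit Types f : M -> 'M[R[i]]_(m, n).

Definition re_entry e f i j (p : R * R) : R :=
  complex.Re (f (param e (cpoint p)) i j).
Definition im_entry e f i j (p : R * R) : R :=
  complex.Im (f (param e (cpoint p)) i j).

Definition smooth_on e f : Prop :=
  forall i j, Cinfty (cpoint @^-1` zcoord_image e) (re_entry e f i j) /\
              Cinfty (cpoint @^-1` zcoord_image e) (im_entry e f i j).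

Definition smooth A f : Prop := forall e, A e -> smooth_on e f.

Definition partial (v : R * R) e f (x : M) : 'M[R[i]]_(m, n) :=
  \matrix_(i, j) ('D_v (re_entry e f i j) (rpoint (zcoord e x)) +i*
                  'D_v (im_entry e f i j) (rpoint (zcoord e x))).

Definition dz e f (x : M) : 'M[R[i]]_(m, n) :=
  (2^-1 : R[i]) *: (partial (1, 0) e f x - (0 +i* 1) *: partial (0, 1) e f x).

Definition dzbar e f (x : M) : 'M[R[i]]_(m, n) :=
  (2^-1 : R[i]) *: (partial (1, 0) e f x + (0 +i* 1) *: partial (0, 1) e f x).

End Derivatives.

(* A map into a submanifold N of the Euclidean space of square matrices, with
   inner product Re tr(X Y^* ), is harmonic iff its tension field vanishes,
   i.e. iff its Laplacian is everywhere normal to N.  On a surface the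
   Laplacian of any conformal metric is a positive multiple of
   d/dz d/dzbar.  [T p] is the tangent space of N at p. *)
Definition harmonic_into n (T : 'M[R[i]]_n -> set 'M[R[i]]_n) A
    (f : M -> 'M[R[i]]_n) : Prop :=
  smooth A f /\
  forall e x v, A e -> dom e x -> T (f x) v ->
    complex.Re (\tr (dz e (dzbar e f) x *m v ^t*)) = 0.

(* Kernel at p of the differential of p |-> p^* p. *)
Definition unitary_tangent n (p : 'M[R[i]]_n) : set 'M[R[i]]_n :=
  [set v | v ^t* *m p + p ^t* *m v = 0].

(* Kernel at p of the differential of p |-> (p^* - p, p p - p). *)
Definition grassmann_tangent n (p : 'M[R[i]]_n) : set 'M[R[i]]_n :=
  [set v | v ^t* = v /\ v *m p + p *m v = v].

Definition harmonic_unitary n A (f : M -> 'M[R[i]]_n) : Prop :=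
  (forall x, f x \is unitarymx) /\ harmonic_into (@unitary_tangent n) A f.

(* A subspace of C^n (column vectors) is represented by the orthogonal
   projection onto it. *)
Definition orthoproj n (k : nat) (p : 'M[R[i]]_n) : Prop :=
  [/\ p ^t* = p, p *m p = p & \rank p = k].

(* Smooth maps M -> G_k(C^n), or equivalently smooth rank k subbundles of
   M x C^n, given by their projection. *)
Definition subbundle n (k : nat) A (phi : M -> 'M[R[i]]_n) : Prop :=
  smooth A phi /\ forall x, orthoproj k (phi x).

Definition harmonic_grassmann n (k : nat) A (phi : M -> 'M[R[i]]_n) : Prop :=
  subbundle k A phi /\ harmonic_into (@grassmann_tangent n) A phi.

Definition fiber n (phi : M -> 'M[R[i]]_n) (x : M) : set 'cV[R[i]]_n :=
  [set w | phi x *m w = w].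

Definition section_on n e (phi : M -> 'M[R[i]]_n) (s : M -> 'cV[R[i]]_n) : Prop :=
  smooth_on e s /\ forall x, dom e x -> fiber phi x (s x).

(* With [D] equal to [@dz n 1] (resp. [@dzbar n 1]) this is the image at x of
   A'_phi (resp. A''_phi). *)
Definition second_form_image n
    (D : chart R M -> (M -> 'cV[R[i]]_n) -> M -> 'cV[R[i]]_n) e
    (phi : M -> 'M[R[i]]_n) (x : M) : set 'cV[R[i]]_n :=
  [set w | exists2 s, section_on e phi s & w = (1%:M - phi x) *m D e s x].

(* psi is the subbundle extending the images of A'_phi (resp. A''_phi): the
   two agree off a set of isolated points. *)
Definition extends_image n
    (D : chart R M -> (M -> 'cV[R[i]]_n) -> M -> 'cV[R[i]]_n) A
    (phi psi : M -> 'M[R[i]]_n) : Prop :=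
  forall e x, A e -> dom e x ->
    \forall y \near x^', fiber psi y = second_form_image D e phi y.

Definition is_gauss' n (k : nat) A (phi psi : M -> 'M[R[i]]_n) : Prop :=
  subbundle k A psi /\ extends_image (@dz n 1) A phi psi.

Definition is_gauss'' n (k : nat) A (phi psi : M -> 'M[R[i]]_n) : Prop :=
  subbundle k A psi /\ extends_image (@dzbar n 1) A phi psi.

(* The shared k says that G'(phi) has the same rank as phi. *)
Definition irreducible' n A (phi : M -> 'M[R[i]]_n) : Prop :=
  exists k psi, subbundle k A phi /\ is_gauss' k A phi psi.

Definition irreducible'' n A (phi : M -> 'M[R[i]]_n) : Prop :=
  exists k psi, subbundle k A phi /\ is_gauss'' k A phi psi.

Definition reducible' n A (phi : M -> 'M[R[i]]_n) : Prop := ~ irreducible' A phi.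

Definition Az n e (f : M -> 'M[R[i]]_n) (x : M) : 'M[R[i]]_n :=
  (2^-1 : R[i]) *: (invmx (f x) *m dz e f x).

Definition Azbar n e (f : M -> 'M[R[i]]_n) (x : M) : 'M[R[i]]_n :=
  (2^-1 : R[i]) *: (invmx (f x) *m dzbar e f x).

Definition is_uniton n A (f alpha : M -> 'M[R[i]]_n) : Prop :=
  [/\ harmonic_unitary A f, (exists k, subbundle k A alpha) &
      forall e s, A e -> section_on e alpha s ->
        section_on e alpha (fun x => dzbar e s x + Azbar e f x *m s x) /\
        section_on e alpha (fun x => Az e f x *m s x)].

Definition reflection n (alpha : M -> 'M[R[i]]_n) (x : M) : 'M[R[i]]_n :=
  alpha x - (1%:M - alpha x).

Inductive finite_uniton_number n A : (M -> 'M[R[i]]_n) -> Prop :=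
| FiniteUnitonConst (u : 'M[R[i]]_n) :
    u \is unitarymx -> finite_uniton_number A (fun=> u)
| FiniteUnitonMul (f alpha : M -> 'M[R[i]]_n) :
    finite_uniton_number A f -> is_uniton A f alpha ->
    finite_uniton_number A (fun x => f x *m reflection alpha x).

End RiemannSurface.

(* Main.v *)
(* Let A = A_z for the map phi.  Finite uniton number gives, by induction on
   the number of unitons, that A is nilpotent and that there is a polynomial
   X(t), t the inverse spectral parameter, with d/dz X = (1 - t) X A and X(1)
   invertible.  Suppose that psi = G'(phi) were d'-irreducible, and work near a
   point where phi, psi and the second fundamental forms all have rank 2.  Let
   X_k be a coefficient of X such that X_(k+1) = 0.  Then X_k A = 0, and since A
   maps phi onto psi and phi^perp onto phi, X_k kills phi and psi.  As A is
   nilpotent it kills a nonzero v in psi; then w = A'_psi v is nonzero and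
   orthogonal to phi and psi.  Differentiating X_k psi = 0 and using
   d/dz X_k = (X_k - X_(k-1)) A gives X_k w = 0.  As phi, psi and w span C^5,
   X_k = 0; descending in k, X = 0, contradicting the invertibility of X(1). *)
Require Import Defs.
From mathcomp Require Import all_boot all_order all_algebra.
From mathcomp Require Import complex zify ring lra.
From mathcomp Require Import all_classical all_reals all_analysis.
Import Order.TTheory GRing.Theory Num.Theory.
Import numFieldNormedType.Exports.
Local Open Scope classical_set_scope.
Local Open Scope ring_scope.
Local Open Scope complex_scope.
Local Open Scope sesquilinear_scope.
Set Implicit Arguments.
Unset Strict Implicit.
Unset Printing Implicit Defensive.

(** * Partial derivatives of matrix-valued maps, computed in a chart *)

Section Calculus.
Variables (R : realType) (M : topologicalType).
Local Notation C := (R[i] : numFieldType).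
Local Notation cpoint := Defs.cpoint.
Implicit Types (e : chart R M) (x : M) (v : R * R).

Lemma ReM (z w : R[i]) :
  complex.Re (z * w) = complex.Re z * complex.Re w - complex.Im z * complex.Im w.
Proof. by case: z w => [a b] [c d]. Qed.

Lemma ImM (z w : R[i]) :
  complex.Im (z * w) = complex.Re z * complex.Im w + complex.Im z * complex.Re w.
Proof. by case: z w => [a b] [c d]. Qed.

(** Existence and value are kept together: ['D_v] takes a default value where there is no
    derivative, so [partial] alone obeys no calculus rules. *)
Definition has_partial m n v e (f : M -> 'M[R[i]]_(m, n)) x (D : 'M[R[i]]_(m, n)) :=
  forall i j,
    is_derive (rpoint (zcoord e x)) v (re_entry e f i j) (complex.Re (D i j)) /\
    is_derive (rpoint (zcoord e x)) v (im_entry e f i j) (complex.Im (D i j)).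

Lemma has_partialE m n v e (f : M -> 'M[R[i]]_(m, n)) x D :
  has_partial v e f x D -> partial v e f x = D.
Proof.
move=> h; apply/matrixP => i j; rewrite mxE.
have [/@derive_val -> /@derive_val ->] := h i j.
by case: (D i j).
Qed.

Lemma has_partial_cst m n v e x (c : 'M[R[i]]_(m, n)) :
  has_partial v e (fun=> c) x 0.
Proof. by move=> i j; rewrite mxE; split; apply: is_derive_cst. Qed.

Lemma has_partialD m n v e (f g : M -> 'M[R[i]]_(m, n)) x D E :
  has_partial v e f x D -> has_partial v e g x E ->
  has_partial v e (fun y => f y + g y) x (D + E).
Proof.
move=> hf hg i j; have [f1 f2] := hf i j; have [g1 g2] := hg i j.
rewrite mxE !raddfD /=; split.
- have -> : re_entry e (fun y => f y + g y) i j = re_entry e f i j + re_entry e g i j.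
    by apply/funext => p; rewrite /re_entry mxE raddfD.
  exact: is_deriveD.
- have -> : im_entry e (fun y => f y + g y) i j = im_entry e f i j + im_entry e g i j.
    by apply/funext => p; rewrite /im_entry mxE raddfD.
  exact: is_deriveD.
Qed.

Lemma has_partialN m n v e (f : M -> 'M[R[i]]_(m, n)) x D :
  has_partial v e f x D -> has_partial v e (fun y => - f y) x (- D).
Proof.
move=> hf i j; have [f1 f2] := hf i j.
rewrite mxE !raddfN /=; split.
- have -> : re_entry e (fun y => - f y) i j = - re_entry e f i j.
    by apply/funext => p; rewrite /re_entry mxE raddfN.
  exact: is_deriveN.
- have -> : im_entry e (fun y => - f y) i j = - im_entry e f i j.
    by apply/funext => p; rewrite /im_entry mxE raddfN.
  exact: is_deriveN.
Qed.

(** The product rule yields the values of f and g at [param e (zcoord e x)]; the first hypothesis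
    identifies them with those at x. *)
Lemma has_partialM m n k v e (f : M -> 'M[R[i]]_(m, n))
    (g : M -> 'M[R[i]]_(n, k)) x D E :
  param e (zcoord e x) = x ->
  has_partial v e f x D -> has_partial v e g x E ->
  has_partial v e (fun y => f y *m g y) x (D *m g x + f x *m E).
Proof.
move=> ex hf hg i j; set p := rpoint (zcoord e x).
have px : param e (cpoint p) = x.
  by rewrite /p /rpoint /cpoint /=; case: (zcoord e x) ex.
have dre l : is_derive p v (re_entry e f i l * re_entry e g l j -
    im_entry e f i l * im_entry e g l j)
    (complex.Re (D i l * g x l j + f x i l * E l j)).
  have [f1 f2] := hf i l; have [g1 g2] := hg l j.
  apply: (is_derive_eq (is_deriveB (is_deriveM f1 g1) (is_deriveM f2 g2))).
  rewrite /re_entry /im_entry -/p px [RHS]raddfD /= !ReM /GRing.scale /=; ring.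
have dim l : is_derive p v (re_entry e f i l * im_entry e g l j +
    im_entry e f i l * re_entry e g l j)
    (complex.Im (D i l * g x l j + f x i l * E l j)).
  have [f1 f2] := hf i l; have [g1 g2] := hg l j.
  apply: (is_derive_eq (is_deriveD (is_deriveM f1 g2) (is_deriveM f2 g1))).
  rewrite /re_entry /im_entry -/p px [RHS]raddfD /= !ImM /GRing.scale /=; ring.
have -> : (D *m g x + f x *m E) i j = \sum_l (D i l * g x l j + f x i l * E l j).
  by rewrite 3!mxE -big_split.
split.
- have -> : re_entry e (fun y => f y *m g y) i j =
      \sum_l (re_entry e f i l * re_entry e g l j - im_entry e f i l * im_entry e g l j).
    apply/funext => q; rewrite /re_entry mxE raddf_sum fct_sumE.
    by apply: eq_bigr => l _ /=; rewrite ReM.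
  by rewrite (raddf_sum (@complex.Re R)); exact: (is_derive_sum dre).
- have -> : im_entry e (fun y => f y *m g y) i j =
      \sum_l (re_entry e f i l * im_entry e g l j + im_entry e f i l * re_entry e g l j).
    apply/funext => q; rewrite /im_entry mxE raddf_sum fct_sumE.
    by apply: eq_bigr => l _ /=; rewrite ImM.
  by rewrite (raddf_sum (@complex.Im R)); exact: (is_derive_sum dim).
Qed.

Lemma has_partial_adj m n v e (f : M -> 'M[R[i]]_(m, n)) x D :
  has_partial v e f x D -> has_partial v e (fun y => (f y) ^t*) x (D ^t*).
Proof.
have ReC (z : R[i]) : complex.Re (Num.conj z) = complex.Re z by case: z.
have ImC (z : R[i]) : complex.Im (Num.conj z) = - complex.Im z by case: z.
move=> hf i j; have [f1 f2] := hf j i.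
rewrite !mxE ReC ImC; split.
- have -> // : re_entry e (fun y => (f y) ^t*) i j = re_entry e f j i.
  by apply/funext => p; rewrite /re_entry !mxE ReC.
- have -> : im_entry e (fun y => (f y) ^t*) i j = - im_entry e f j i.
    by apply/funext => p; rewrite /im_entry !mxE ImC.
  exact: is_deriveN.
Qed.

Lemma cpoint_continuous : continuous (@cpoint R : R * R -> C).
Proof.
move=> p; apply/cvgrPdist_lt => eps eps0.
have [r r0 ->] : exists2 r : R, 0 < r & eps = r%:C.
  by case: eps eps0 => a b; rewrite ltcE /= => /andP[/eqP -> ?]; exists a.
(* [R * R] carries the maximum norm; coordinates within r/2 give a modulus below r / sqrt 2, hence
   below r. *)
have r20 : 0 < r / 2 by rewrite divr_gt0.
near=> q.
have : `|p - q| < r / 2 by near: q; apply: cvgr_dist_lt.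
rewrite prod_normE /= gt_max => /andP[/ltr_normlP [a1 a2] /ltr_normlP [b1 b2]].
rewrite normc_def ltcR /= -[r in ltRHS](ger0_norm (ltW r0)) -sqrtr_sqr.
rewrite ltr_sqrt ?exprn_gt0 // !expr2; nra.
Unshelve. all: by end_near.
Qed.

Lemma near_chart e x (Q : M -> Prop) :
  is_chart e -> dom e x -> (\forall y \near x, Q y) ->
  \forall p \near rpoint (zcoord e x), Q (param e (cpoint p)).
Proof.
move=> [_ _ pz _ cp] ex Qx.
have zx : cpoint (rpoint (zcoord e x)) = zcoord e x by case: (zcoord e x).
have zi : zcoord e x \in zcoord_image e by apply/mem_set; exists x.
apply: (@cpoint_continuous (rpoint (zcoord e x)) (Q \o param e)).
by rewrite zx; apply: cp => //; rewrite pz.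
Qed.

Lemma has_partial_near m n v e (f g : M -> 'M[R[i]]_(m, n)) x D :
  is_chart e -> dom e x -> (\forall y \near x, f y = g y) ->
  has_partial v e f x D -> has_partial v e g x D.
Proof.
move=> ce ex /(near_chart ce ex) fg hf i j; have [f1 f2] := hf i j; split.
- by apply: near_eq_is_derive f1; near=> p; rewrite /re_entry (near fg p).
- by apply: near_eq_is_derive f2; near=> p; rewrite /im_entry (near fg p).
Unshelve. all: by end_near.
Qed.

End Calculus.

(** * Linear algebra of projections and nilpotent matrices *)

Section MatrixAlgebra.
Variable F : fieldType.

(** The row space of [B *m A] lies in that of A, and the rank bound forces equality. *)
Lemma left_factor m n k (A : 'M[F]_(m, n)) (B : 'M[F]_(k, m)) :
  (\rank A <= \rank (B *m A))%N -> exists W, A = W *m (B *m A).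
Proof.
move=> h; apply/submxP; have [_ <-] := mxrank_leqif_sup (submxMl B A).
by rewrite eqn_leq h mxrankM_maxr.
Qed.

Lemma right_factor m n k (A : 'M[F]_(m, n)) (B : 'M[F]_(n, k)) :
  (\rank A <= \rank (A *m B))%N -> exists W, A = A *m B *m W.
Proof.
rewrite -[\rank A]mxrank_tr -[\rank (A *m B)]mxrank_tr trmx_mul => /left_factor [W eW].
by exists W^T; rewrite -[LHS]trmxK eW !trmx_mul !trmxK.
Qed.

Lemma factor_of_cols m n k (A : 'M[F]_(m, k)) (B : 'M[F]_(m, n)) :
  (forall j, exists w, col j A = B *m w) -> exists U, A = B *m U.
Proof.
move=> /choice [w hw]; exists (\matrix_(i, j) w j i 0).
apply/matrixP => i j; have /matrixP/(_ i 0) := hw j; rewrite !mxE => ->.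
by apply: eq_bigr => l _; rewrite mxE.
Qed.

Definition nilpotent_mx n (A : 'M[F]_n) : Prop := exists N, A ^+ N = 0.

Lemma complement_idem n (P : 'M[F]_n) : P *m P = P ->
  [/\ P *m (1%:M - P) = 0, (1%:M - P) *m P = 0,
      (1%:M - P) *m (1%:M - P) = 1%:M - P & P + (1%:M - P) = 1%:M].
Proof.
move=> PP; have PQ : P *m (1%:M - P) = 0 by rewrite mulmxBr mulmx1 PP subrr.
have QP : (1%:M - P) *m P = 0 by rewrite mulmxBl mul1mx PP subrr.
by split; rewrite // ?[P + _]addrC ?subrK // mulmxBl mul1mx PQ subr0.
Qed.

(* The effect on [a] = A_z of adding the uniton with projection [P]. *)
Lemma uniton_block n (P a dP : 'M[F]_n) :
  (1%:M - P) *m a *m P = 0 -> P *m a *m (1%:M - P) = P *m dP ->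
  (P - (1%:M - P)) *m (a *m (P - (1%:M - P)) + dP) =
  P *m a *m P + (1%:M - P) *m a *m (1%:M - P) - (1%:M - P) *m dP.
Proof.
move: (1%:M - P) => Q QaP PaQ.
rewrite mulmxBl !mulmxDr !mulmxN !mulmxA PaQ QaP subrK sub0r.
by rewrite opprD opprK addrA.
Qed.

(* If X(t) solves dX = (1 - t) X a, then X(t) (t P + Q) solves the equation
   of the map obtained by adding the uniton P. *)
Lemma uniton_gauge n (P a dP X Y Z : 'M[F]_n) :
  P *m P = P -> (1%:M - P) *m a *m P = 0 ->
  P *m a *m (1%:M - P) = P *m dP ->
  (Y - Z) *m a *m P + Y *m dP + ((X - Y) *m a *m (1%:M - P) + X *m - dP) =
  (Y *m P + X *m (1%:M - P) - (Z *m P + Y *m (1%:M - P))) *m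
  (P *m a *m P + (1%:M - P) *m a *m (1%:M - P) - (1%:M - P) *m dP).
Proof.
move=> PP; have [PQ QP QQ] := complement_idem PP.
move: (1%:M - P) PQ QP QQ => Q PQ QP QQ PQ1 QaP PaQ.
have aP : a *m P = P *m a *m P.
  by rewrite -[LHS]mul1mx -PQ1 mulmxDl !mulmxA QaP addr0.
have aQ : a *m Q = P *m dP + Q *m a *m Q.
  by rewrite -[LHS]mul1mx -PQ1 mulmxDl !mulmxA PaQ.
have dPE : dP = P *m dP + Q *m dP by rewrite -mulmxDl PQ1 mul1mx.
set T := P *m a *m P + _ - _.
have PT : P *m T = P *m a *m P.
  by rewrite mulmxBr mulmxDr !mulmxA PQ PP !mul0mx addr0 subr0.
have QT : Q *m T = Q *m a *m Q - Q *m dP.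
  by rewrite mulmxBr mulmxDr !mulmxA QP QQ !mul0mx add0r.
have -> : Y *m P + X *m Q - (Z *m P + Y *m Q) = (Y - Z) *m P + (X - Y) *m Q.
  by rewrite opprD addrACA -!mulmxBl.
have -> : (Y - Z) *m a *m P = (Y - Z) *m (P *m T) by rewrite PT -mulmxA aP.
have -> : (X - Y) *m a *m Q = (X - Y) *m (P *m dP + Q *m a *m Q) by rewrite -mulmxA aQ.
rewrite [RHS]mulmxDl -[_ *m P *m T]mulmxA -[_ *m Q *m T]mulmxA QT -addrA.
congr (_ + _); rewrite addrCA.
have -> : Y *m dP + X *m - dP = (X - Y) *m - dP.
  by rewrite mulmxBl !mulmxN opprK addrC.
rewrite -mulmxDr; congr (_ *m _).
by rewrite {2}dPE [P *m dP + _]addrC opprD addrA addrK.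
Qed.

(** In blocks for P and 1 - P, A is triangular one way and T the other, with equal diagonal blocks.
    The diagonal blocks of their powers then agree, so once A^N = 0 only one corner of T^N is left,
    and its square is 0. *)
Lemma nilpotent_block n (A T P : 'M[F]_n) :
  P *m P = P -> (1%:M - P) *m A *m P = 0 ->
  P *m T *m P = P *m A *m P -> P *m T *m (1%:M - P) = 0 ->
  (1%:M - P) *m T *m (1%:M - P) = (1%:M - P) *m A *m (1%:M - P) ->
  nilpotent_mx A -> nilpotent_mx T.
Proof.
set Q := 1%:M - P => PP QAP TPP TPQ TQQ [N AN].
have PQ1 : P + Q = 1%:M by rewrite /Q addrC subrK.
have PQ0 : P *m Q = 0 by rewrite mulmxBr mulmx1 PP subrr.
have QQ : Q *m Q = Q by rewrite {1}/Q mulmxBl mul1mx PQ0 subr0.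
have QP0 : Q *m P = 0 by rewrite mulmxBl mul1mx PP subrr.
clearbody Q.
have blockM E B C G : E *m (B *m C) *m G =
    (E *m B *m P) *m (P *m C *m G) + (E *m B *m Q) *m (Q *m C *m G).
  rewrite !mulmxA -[_ *m P *m P]mulmxA PP -[_ *m Q *m Q]mulmxA QQ.
  by rewrite -!mulmxDl -mulmxDr PQ1 mulmx1.
have AkP k : Q *m A ^+ k *m P = 0.
  elim: k => [|k IH]; first by rewrite expr0 mulmx1.
  by rewrite exprS blockM QAP mul0mx IH mulmx0 addr0.
have TkQ k : P *m T ^+ k *m Q = 0.
  elim: k => [|k IH]; first by rewrite expr0 mulmx1.
  by rewrite exprS blockM TPQ mul0mx IH mulmx0 addr0.
have TkPP k : P *m T ^+ k *m P = P *m A ^+ k *m P.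
  elim: k => [|k IH]; first by rewrite !expr0.
  by rewrite !exprS !blockM TPQ mul0mx AkP mulmx0 TPP IH.
have TkQQ k : Q *m T ^+ k *m Q = Q *m A ^+ k *m Q.
  elim: k => [|k IH]; first by rewrite !expr0.
  by rewrite !exprS !blockM TkQ mulmx0 QAP mul0mx TQQ IH.
have TN : T ^+ N = Q *m T ^+ N *m P.
  have {1}-> : T ^+ N = (P + Q) *m T ^+ N *m (P + Q) by rewrite PQ1 mulmx1 mul1mx.
  rewrite !mulmxDl !mulmxDr.
  by rewrite TkQ TkPP TkQQ AN !mulmx0 !mul0mx !addr0 add0r.
exists (N + N)%N; rewrite exprD {1}TN TN -mulmxE.
by rewrite !mulmxA -[_ *m P *m Q]mulmxA PQ0 mulmx0 !mul0mx.
Qed.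

(** This is A_z after adding the uniton P. As dP exchanges the images of P and 1 - P, the last term
    is a pure corner and the diagonal blocks are those of a. *)
Lemma nilpotent_uniton n (P a dP : 'M[F]_n) :
  P *m P = P -> dP *m P + P *m dP = dP -> (1%:M - P) *m a *m P = 0 ->
  nilpotent_mx a ->
  nilpotent_mx (P *m a *m P + (1%:M - P) *m a *m (1%:M - P) - (1%:M - P) *m dP).
Proof.
move=> PP ddP QaP; apply: (nilpotent_block PP QaP).
all: have [PQ QP QQ _] := complement_idem PP.
all: have dPQ : dP *m (1%:M - P) = P *m dP by rewrite mulmxBr mulmx1 -{1}ddP addrC addKr.
all: move: (1%:M - P) PQ QP QQ dPQ => Q PQ QP QQ dPQ; rewrite mulmxBr mulmxDr !mulmxA.
- by rewrite PQ PP !mul0mx addr0 subr0 -[_ *m P *m P]mulmxA PP.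
- by rewrite PQ PP !mul0mx addr0 subr0 -[_ *m P *m Q]mulmxA PQ mulmx0.
- rewrite QP QQ !mul0mx add0r mulmxBl -[Q *m dP *m Q]mulmxA dPQ mulmxA QP mul0mx.
  by rewrite subr0 -[_ *m Q *m Q]mulmxA QQ.
Qed.

(** Sandwiching the Leibniz identity between two factors P gives T + T = T for T = P dP P. *)
Lemma idem_derivative n (P dP : 'M[F]_n) :
  P *m P = P -> dP *m P + P *m dP = dP -> P *m dP *m P = 0.
Proof.
move=> PP ddP; have := congr1 (fun X => P *m X *m P) ddP.
rewrite mulmxDr mulmxDl !mulmxA PP -!mulmxA PP => /eqP.
by rewrite -subr_eq0 addrK => /eqP.
Qed.

(** A maps the image of P injectively into that of S, and that of S into that of P. Were A injective
    on the image of S too, all its powers would be injective on the image of P, against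
    nilpotency. *)
Lemma kernel_on_image n (P S dP A : 'M[F]_n) V :
  P != 0 -> P *m P = P -> P *m S = 0 ->
  dP *m P + P *m dP = dP -> S *m (dP *m P) = dP *m P ->
  P = V *m (dP *m P) -> A = P *m dP - dP *m P -> nilpotent_mx A ->
  exists v : 'cV_n, [/\ S *m v = v, A *m v = 0 & v != 0].
Proof.
move=> P0 PP PS ddP SdP VE AE [N AN].
have PdPP := idem_derivative PP ddP.
apply: contrapT => noker.
(* A alternates between the two images, so the induction has to cover vectors of both. *)
have inj k (w : 'cV_n) : P *m w = w \/ S *m w = w -> A ^+ k *m w = 0 -> w = 0.
  elim: k w => [|k IH] w; first by rewrite expr0 mul1mx.
  rewrite exprSr -mulmxE -mulmxA => -[Pw|Sw] /IH h.
    have Aw : A *m w = - (dP *m P *m w).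
      by rewrite AE mulmxBl -{1}Pw !mulmxA PdPP mul0mx sub0r.
    have {}h : A *m w = 0 by apply: h; right; rewrite Aw mulmxN mulmxA SdP.
    by rewrite -Pw VE -mulmxA -[_ *m w]opprK -Aw h oppr0 mulmx0.
  have Pw : P *m w = 0 by rewrite -Sw mulmxA PS mul0mx.
  have Aw : A *m w = P *m dP *m w.
    by rewrite AE mulmxBl -[dP *m P *m w]mulmxA Pw mulmx0 subr0.
  have {}h : A *m w = 0 by apply: h; left; rewrite Aw !mulmxA PP.
  apply: contrapT => w0; apply: noker; exists w; split => //; exact/eqP.
move/eqP: P0; apply; apply/matrixP => i j.
have : col j P = 0.
  by apply: (inj N); [left; rewrite !colE mulmxA PP|rewrite AN mul0mx].
by move=> /matrixP/(_ i 0); rewrite !mxE.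
Qed.

(** T = 1 - P - S has rank at most 1 and fixes w, so its columns are multiples of w and X T = 0; but
    X T = X since X kills P and S. *)
Lemma annihilator_eq0 n (P S X : 'M[F]_n) (w : 'cV_n) :
  P *m P = P -> S *m S = S -> P *m S = 0 -> S *m P = 0 ->
  (n <= (\rank P + \rank S).+1)%N ->
  X *m P = 0 -> X *m S = 0 -> X *m w = 0 ->
  P *m w = 0 -> S *m w = 0 -> w != 0 -> X = 0.
Proof.
move=> PP SS PS SP rk XP XS Xw Pw Sw w0.
set E := P + S; pose T := 1%:M - E.
have PE : P *m E = P by rewrite mulmxDr PP PS addr0.
have SE : S *m E = S by rewrite mulmxDr SS SP add0r.
have TE : T *m E = 0 by rewrite mulmxBl mul1mx {3}/E mulmxDl PE SE subrr.
have Tw : T *m w = w by rewrite mulmxBl mul1mx mulmxDl Pw Sw addr0 subr0.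
have XT : X *m T = X by rewrite mulmxBr mulmx1 mulmxDr XP XS addr0 subr0.
have rkE : (\rank P + \rank S <= \rank E)%N.
  (* Rows common to both row spaces are fixed by P on the right and have the form V S, so S P = 0
     kills them. *)
  have dPS : (P :&: S)%MS = 0.
    apply/eqP; rewrite -submx0; set K := (P :&: S)%MS.
    have /submxP [U KU] : (K <= P)%MS by exact: capmxSl.
    have /submxP [V KV] : (K <= S)%MS by exact: capmxSr.
    by rewrite KU -PP mulmxA -KU KV -mulmxA SP mulmx0 submx0.
  have := mxrank_sum_cap P S; rewrite dPS mxrank0 addn0 => <-.
  apply: mxrankS; rewrite addsmx_sub.
  by apply/andP; split; apply/submxP; [exists P|exists S].
have rkT : (\rank T <= \rank (T *m w))%N.
  rewrite Tw; have -> : \rank w = 1%N.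
    apply/eqP; rewrite eqn_leq rank_leq_col lt0n.
    by rewrite mxrank_eq0.
  have := mulmx0_rank_max TE; lia.
have [W eT] := right_factor rkT.
by rewrite -XT eT Tw mulmxA Xw mul0mx.
Qed.

(* Below [P] and [S] project onto phi and G'(phi), [dP] and [dS] are their
   z-derivatives and [a] is A_z; the factorizations [V1], [V2], [V3] express
   that A'_phi, the component phi^perp -> phi of [a], and A'_{G'(phi)} have
   full rank. *)
Lemma annihilator_images n (P S dP a X W V2 : 'M[F]_n) :
  P *m P = P -> dP *m P + P *m dP = dP -> a = P *m dP - dP *m P ->
  S = dP *m P *m W -> P = P *m dP *m V2 ->
  X *m a = 0 -> X *m P = 0 /\ X *m S = 0.
Proof.
move=> PP ddP aE SE PE; rewrite aE mulmxBr => /eqP; rewrite subr_eq0 => /eqP Xa.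
(* Multiply X P dP = X dP P on the right by P and use P dP P = 0. *)
have XdPP : X *m (dP *m P) = 0.
  rewrite -{1}PP [dP *m (_ *m _)]mulmxA mulmxA -Xa -mulmxA.
  by rewrite (idem_derivative PP ddP) mulmx0.
split; first by rewrite PE mulmxA Xa XdPP mul0mx.
by rewrite SE mulmxA XdPP mul0mx.
Qed.

(* A kernel vector v of [a] in G'(phi) is mapped by A'_{G'(phi)} to a nonzero
   vector orthogonal to phi and G'(phi), and [X] annihilates it. *)
Lemma top_coefficient_eq0 n (P S dP dS a X dX Y W V1 V3 : 'M[F]_n) :
  P != 0 -> P *m P = P -> S *m S = S -> S *m P = 0 ->
  (n <= (\rank P + \rank S).+1)%N ->
  dP *m P + P *m dP = dP -> dS *m S + S *m dS = dS -> dP *m S + P *m dS = 0 ->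
  S *m (dP *m P) = dP *m P -> S = dP *m P *m W ->
  P = V1 *m (dP *m P) -> S = V3 *m (dS *m S) ->
  a = P *m dP - dP *m P -> nilpotent_mx a ->
  X *m P = 0 -> X *m S = 0 -> dX *m S + X *m dS = 0 -> dX = Y *m a ->
  X = 0.
Proof.
move=> P0 PP SS SP rk ddP ddS dPS SdP SE P1 S1 aE nil XP XS dXS dXE.
have PS : P *m S = 0 by rewrite SE !mulmxA (idem_derivative PP ddP) mul0mx.
have [v [Sv av v0]] := kernel_on_image P0 PP PS ddP SdP P1 aE nil.
have Pv : P *m v = 0 by rewrite -Sv mulmxA PS mul0mx.
have PdPv : P *m dP *m v = 0.
  by move: av; rewrite aE mulmxBl -[dP *m P *m v]mulmxA Pv mulmx0 subr0.
have dPv : dP *m v = 0 by rewrite -ddP mulmxDl PdPv -mulmxA Pv mulmx0 addr0.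
(* With w = dS v, the first two goals are the differentiated identities X S = 0 and P S = 0 applied
   to v, the third is S dS S = 0, and the last uses the factorization of S through dS S. *)
apply: (annihilator_eq0 (w := dS *m v) PP SS PS SP rk XP XS).
- have := congr1 (fun Z => Z *m v) dXS; rewrite mulmxDl mul0mx -!mulmxA Sv.
  by rewrite dXE -mulmxA av mulmx0 add0r.
- have := congr1 (fun Z => Z *m v) dPS; rewrite mulmxDl mul0mx -!mulmxA Sv.
  by rewrite dPv add0r.
- by rewrite -Sv !mulmxA (idem_derivative SS ddS) mul0mx.
- apply: contra_neq v0 => dSv.
  by rewrite -Sv S1 -!mulmxA Sv dSv mulmx0.
Qed.

End MatrixAlgebra.

(** * Wirtinger derivatives *)

Section Wirtinger.
Variables (R : realType) (M : topologicalType).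
Implicit Types (e : chart R M) (x : M) (c : R[i]).

(* [dz] and [dzbar] are the cases c = -i and c = i. *)
Definition wirtinger m n c e (f : M -> 'M[R[i]]_(m, n)) x : 'M[R[i]]_(m, n) :=
  2^-1 *: (partial (1, 0) e f x + c *: partial (0, 1) e f x).

Lemma dzE m n : @dz R M m n = wirtinger (- (0 +i* 1)).
Proof.
by apply/funext => e; apply/funext => f; apply/funext => x; rewrite /wirtinger scaleNr.
Qed.

Lemma dzbarE m n : @dzbar R M m n = wirtinger (0 +i* 1).
Proof. by []. Qed.

(** Weaker than Fréchet differentiability: the two coordinate partials are all that the Wirtinger
    rules use. *)
Definition differentiable_at m n e (f : M -> 'M[R[i]]_(m, n)) x : Prop :=
  exists D E, has_partial (1, 0) e f x D /\ has_partial (0, 1) e f x E.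

Lemma smooth_on_differentiable m n e (f : M -> 'M[R[i]]_(m, n)) x :
  dom e x -> smooth_on e f -> differentiable_at e f x.
Proof.
move=> ex sf; exists (partial (1, 0) e f x), (partial (0, 1) e f x).
have xU : (@Defs.cpoint R @^-1` zcoord_image e) (rpoint (zcoord e x)).
  by exists x => //; rewrite /rpoint /Defs.cpoint /=; case: (zcoord e x).
split=> i j; have [/(_ 1%N) [/(_ _ xU) [rx ry] _ _] /(_ 1%N) [/(_ _ xU) [ix iy] _ _]] := sf i j;
  rewrite mxE /=; split.
- exact: (derivableP rx).
- exact: (derivableP ix).
- exact: (derivableP ry).
- exact: (derivableP iy).
Qed.

Lemma differentiable_cst m n e x (a : 'M[R[i]]_(m, n)) :
  differentiable_at e (fun=> a) x.
Proof. by exists 0, 0; split; apply: has_partial_cst. Qed.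

Lemma differentiableD m n e (f g : M -> 'M[R[i]]_(m, n)) x :
  differentiable_at e f x -> differentiable_at e g x ->
  differentiable_at e (fun y => f y + g y) x.
Proof.
move=> [D [E [fD fE]]] [D' [E' [gD gE]]].
by exists (D + D'), (E + E'); split; apply: has_partialD.
Qed.

Lemma differentiableN m n e (f : M -> 'M[R[i]]_(m, n)) x :
  differentiable_at e f x -> differentiable_at e (fun y => - f y) x.
Proof. by move=> [D [E [fD fE]]]; exists (- D), (- E); split; apply: has_partialN. Qed.

Lemma differentiableB m n e (f g : M -> 'M[R[i]]_(m, n)) x :
  differentiable_at e f x -> differentiable_at e g x ->
  differentiable_at e (fun y => f y - g y) x.
Proof. by move=> df dg; apply: differentiableD => //; apply: differentiableN. Qed.

Lemma differentiable_adj m n e (f : M -> 'M[R[i]]_(m, n)) x :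
  differentiable_at e f x -> differentiable_at e (fun y => (f y) ^t*) x.
Proof.
by move=> [D [E [fD fE]]]; exists (D ^t*), (E ^t*); split; apply: has_partial_adj.
Qed.

Lemma differentiableM m n k e (f : M -> 'M[R[i]]_(m, n))
    (g : M -> 'M[R[i]]_(n, k)) x :
  param e (zcoord e x) = x ->
  differentiable_at e f x -> differentiable_at e g x ->
  differentiable_at e (fun y => f y *m g y) x.
Proof.
move=> ex [D [E [fD fE]]] [D' [E' [gD gE]]].
exists (D *m g x + f x *m D'), (E *m g x + f x *m E').
by split; apply: has_partialM.
Qed.

Lemma wirtinger_cst m n c e x (a : 'M[R[i]]_(m, n)) : wirtinger c e (fun=> a) x = 0.
Proof.
by rewrite /wirtinger !(has_partialE (has_partial_cst _ _ _ _)) scaler0 addr0 scaler0.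
Qed.

Lemma wirtingerD m n c e (f g : M -> 'M[R[i]]_(m, n)) x :
  differentiable_at e f x -> differentiable_at e g x ->
  wirtinger c e (fun y => f y + g y) x = wirtinger c e f x + wirtinger c e g x.
Proof.
move=> [D [E [fD fE]]] [D' [E' [gD gE]]]; rewrite /wirtinger.
rewrite (has_partialE (has_partialD fD gD)) (has_partialE (has_partialD fE gE)).
rewrite (has_partialE fD) (has_partialE fE) (has_partialE gD) (has_partialE gE).
by rewrite -!scalerDr addrACA -scalerDr.
Qed.

Lemma wirtingerN m n c e (f : M -> 'M[R[i]]_(m, n)) x :
  differentiable_at e f x -> wirtinger c e (fun y => - f y) x = - wirtinger c e f x.
Proof.
move=> [D [E [fD fE]]]; rewrite /wirtinger.
rewrite (has_partialE (has_partialN fD)) (has_partialE (has_partialN fE)).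
by rewrite (has_partialE fD) (has_partialE fE) scalerN -opprD scalerN.
Qed.

Lemma wirtingerB m n c e (f g : M -> 'M[R[i]]_(m, n)) x :
  differentiable_at e f x -> differentiable_at e g x ->
  wirtinger c e (fun y => f y - g y) x = wirtinger c e f x - wirtinger c e g x.
Proof.
by move=> df dg; rewrite wirtingerD ?wirtingerN //; apply: differentiableN.
Qed.

Lemma wirtingerM m n k c e (f : M -> 'M[R[i]]_(m, n))
    (g : M -> 'M[R[i]]_(n, k)) x :
  param e (zcoord e x) = x ->
  differentiable_at e f x -> differentiable_at e g x ->
  wirtinger c e (fun y => f y *m g y) x =
  wirtinger c e f x *m g x + f x *m wirtinger c e g x.
Proof.
move=> ex [D [E [fD fE]]] [D' [E' [gD gE]]]; rewrite /wirtinger.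
rewrite (has_partialE (has_partialM ex fD gD)) (has_partialE (has_partialM ex fE gE)).
rewrite (has_partialE fD) (has_partialE fE) (has_partialE gD) (has_partialE gE).
rewrite -scalemxAl -scalemxAr -scalerDr mulmxDl mulmxDr [c *: (_ + _)]scalerDr.
by rewrite -scalemxAl -scalemxAr addrACA.
Qed.

Lemma wirtinger_near m n c e (f g : M -> 'M[R[i]]_(m, n)) x :
  is_chart e -> dom e x -> differentiable_at e f x ->
  (\forall y \near x, f y = g y) -> wirtinger c e f x = wirtinger c e g x.
Proof.
move=> ce ex [D [E [fD fE]]] fg; rewrite /wirtinger.
rewrite (has_partialE fD) (has_partialE fE).
by rewrite (has_partialE (has_partial_near ce ex fg fD))
  (has_partialE (has_partial_near ce ex fg fE)).
Qed.

Lemma wirtinger_col m n c e (f : M -> 'M[R[i]]_(m, n)) x j :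
  wirtinger c e (fun y => col j (f y)) x = col j (wirtinger c e f x).
Proof.
apply/matrixP => i k; rewrite !mxE.
have -> : re_entry e (fun y => col j (f y)) i k = re_entry e f i j.
  by apply/funext => p; rewrite /re_entry mxE.
have -> // : im_entry e (fun y => col j (f y)) i k = im_entry e f i j.
by apply/funext => p; rewrite /im_entry mxE.
Qed.

(** Conjugation turns i into -i; this converts facts about [dzbar] into facts about [dz]. *)
Lemma dzbar_adj m n e (f : M -> 'M[R[i]]_(m, n)) x :
  differentiable_at e f x ->
  (dzbar e f x) ^t* = dz e (fun y => (f y) ^t*) x.
Proof.
have conj2 : Num.conj (2^-1 : R[i]) = 2^-1 by rewrite fmorphV rmorph_nat.
have conji : Num.conj (0 +i* 1 : R[i]) = - (0 +i* 1).
  by apply/eqP; rewrite eq_complex /= oppr0 !eqxx.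
move=> [D [E [fD fE]]]; rewrite dzE dzbarE /wirtinger.
rewrite (has_partialE (has_partial_adj fD)) (has_partialE (has_partial_adj fE)).
rewrite (has_partialE fD) (has_partialE fE).
by apply/matrixP => i j; rewrite !mxE rmorphM rmorphD rmorphM /= conj2 conji.
Qed.

Lemma smooth_on_col m n e (f : M -> 'M[R[i]]_(m, n)) j :
  smooth_on e f -> smooth_on e (fun y => col j (f y)).
Proof.
move=> sf i k; have [? ?] := sf i j.
have -> : re_entry e (fun y => col j (f y)) i k = re_entry e f i j.
  by apply/funext => p; rewrite /re_entry mxE.
have -> // : im_entry e (fun y => col j (f y)) i k = im_entry e f i j.
by apply/funext => p; rewrite /im_entry mxE.
Qed.

End Wirtinger.

(** * Unitons and extended solutions *)

Section Unitons.
Variables (R : realType) (M : topologicalType) (n : nat).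
Implicit Types (e : chart R M) (x : M) (f alpha : M -> 'M[R[i]]_n).

Lemma wirtinger_idem c e f x :
  is_chart e -> dom e x -> differentiable_at e f x ->
  (forall y, f y *m f y = f y) ->
  wirtinger c e f x *m f x + f x *m wirtinger c e f x = wirtinger c e f x.
Proof.
move=> [_ _ pz _ _] ex df ff; rewrite -(wirtingerM c (pz x ex) df df).
by rewrite (_ : (fun y => _) = f) //; apply/funext.
Qed.

Lemma reflection_sqr (P : M -> 'M[R[i]]_n) x :
  P x *m P x = P x -> reflection P x *m reflection P x = 1%:M.
Proof.
move=> PP; have [PQ QP QQ PQ1] := complement_idem PP.
rewrite /reflection; move: (1%:M - _) PQ QP QQ PQ1 => Q PQ QP QQ PQ1.
by rewrite mulmxBl !mulmxBr PP PQ QP QQ subr0 sub0r opprK.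
Qed.

Lemma reflection_differentiable e alpha x :
  differentiable_at e alpha x -> differentiable_at e (reflection alpha) x.
Proof.
move=> da; apply: differentiableB => //.
by apply: differentiableB => //; apply: differentiable_cst.
Qed.

Lemma wirtinger_reflection c e alpha x : differentiable_at e alpha x ->
  wirtinger c e (reflection alpha) x = wirtinger c e alpha x *+ 2.
Proof.
move=> da; have d1 := @differentiable_cst R M n n e x 1%:M.
rewrite (wirtingerB c da (differentiableB d1 da)) (wirtingerB c d1 da).
by rewrite wirtinger_cst sub0r opprK mulr2n.
Qed.

(** A reflection is its own inverse, and its derivative is twice that of alpha, which cancels the
    factor 1/2 in A_z. *)
Lemma Az_mul_reflection e f alpha x :
  is_chart e -> dom e x -> differentiable_at e f x -> differentiable_at e alpha x ->
  f x \in unitmx -> alpha x *m alpha x = alpha x ->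
  Az e (fun y => f y *m reflection alpha y) x =
  reflection alpha x *m (Az e f x *m reflection alpha x + dz e alpha x).
Proof.
move=> [_ _ pz _ _] ex df da uf aa; rewrite /Az !dzE.
have rr := reflection_sqr aa.
have ur : reflection alpha x \in unitmx by have [] := mulmx1_unit rr.
have -> : invmx (f x *m reflection alpha x) = reflection alpha x *m invmx (f x).
  have ufr : f x *m reflection alpha x \in unitmx by rewrite unitmx_mul uf ur.
  have frrf : f x *m reflection alpha x *m (reflection alpha x *m invmx (f x)) = 1%:M.
    by rewrite mulmxA -[_ *m _ *m reflection alpha x]mulmxA rr mulmx1 mulmxV.
  by rewrite -[LHS]mulmx1 -frrf mulKmx.
rewrite (wirtingerM _ (pz x ex) df (reflection_differentiable da)).
rewrite (wirtinger_reflection _ da); move: (wirtinger _ _ _ _) (wirtinger _ _ _ _) => df' da'.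
rewrite [in LHS]mulmxDr [RHS]mulmxDr scalerDr; congr (_ + _).
  by rewrite -scalemxAl -scalemxAr !mulmxA.
rewrite -!mulmxA mulKmx // scalemxAr; congr (_ *m _).
rewrite -[X in _ *: X]scaler_nat scalerA.
by rewrite mulVf ?scale1r // pnatr_eq0.
Qed.

Lemma Az_reflection e alpha x :
  is_chart e -> dom e x -> differentiable_at e alpha x ->
  (forall y, alpha y *m alpha y = alpha y) ->
  Az e (reflection alpha) x = alpha x *m dz e alpha x - dz e alpha x *m alpha x.
Proof.
move=> ce ex da aa.
have -> : reflection alpha = (fun y => 1%:M *m reflection alpha y).
  by apply/funext => y; rewrite mul1mx.
rewrite (@Az_mul_reflection e (fun=> 1%:M) alpha x) ?unitmx1 //; last first.
  exact: differentiable_cst.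
rewrite /Az !dzE wirtinger_cst mulmx0 scaler0 mul0mx add0r.
rewrite /reflection mulmxBl mulmxBl mul1mx; congr (_ - _).
by rewrite -[X in X - _](wirtinger_idem _ ce ex da aa) addrK.
Qed.

(** Differentiate f^* f = 1. *)
Lemma Azbar_adj e f x :
  is_chart e -> dom e x -> differentiable_at e f x ->
  (forall y, f y \is unitarymx) -> (Azbar e f x) ^t* = - Az e f x.
Proof.
move=> [_ _ pz _ _] ex df uf.
have conj2 : Num.conj (2^-1 : R[i]) = 2^-1 by rewrite fmorphV rmorph_nat.
have ff : (fun y => (f y) ^t* *m f y) = fun=> 1%:M.
  apply/funext => y; rewrite -invmx_unitary // mulVmx //; exact: unitarymx_unit.
have := congr1 (fun g => dz e g x) ff.
rewrite dzE wirtinger_cst (wirtingerM _ (pz x ex) (differentiable_adj df) df).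
rewrite -!dzE -dzbar_adj // => /eqP; rewrite addr_eq0 => /eqP h.
rewrite /Azbar /Az linearZ map_mxZ /= conj2 trmx_mul map_mxM /=.
by rewrite invmx_unitary // trmxCK h scalerN.
Qed.

Lemma adjM m k l (B : 'M[R[i]]_(m, k)) (D : 'M[R[i]]_(k, l)) :
  (B *m D) ^t* = D ^t* *m B ^t*.
Proof. by rewrite trmx_mul map_mxM. Qed.

Lemma adjD m k (B D : 'M[R[i]]_(m, k)) : (B + D) ^t* = B ^t* + D ^t*.
Proof. by rewrite raddfD map_mxD. Qed.

Lemma eq_cols m (A B : 'M[R[i]]_(m, n)) : (forall j, col j A = col j B) -> A = B.
Proof. by move=> h; apply/matrixP => i j; have /matrixP/(_ i 0) := h j; rewrite !mxE. Qed.

Lemma section_on_col e k alpha (A : set (chart R M)) j : A e ->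
  subbundle k A alpha -> section_on e alpha (fun y => col j (alpha y)).
Proof.
move=> Ae [sa oa]; split; first exact/smooth_on_col/sa.
move=> y _; have [_ aa _] := oa y.
by rewrite /fiber /= !colE mulmxA aa.
Qed.

(** The columns of alpha are sections spanning its fibres, so the two closure conditions become
    matrix identities. The one for [dzbar] turns into a condition on A_z by taking adjoints. *)
Lemma uniton_invariance (A : set (chart R M)) e f alpha x :
  A e -> is_chart e -> dom e x -> is_uniton A f alpha ->
  (1%:M - alpha x) *m Az e f x *m alpha x = 0 /\
  alpha x *m Az e f x *m (1%:M - alpha x) = alpha x *m dz e alpha x.
Proof.
move=> Ae ce ex [[uf [sf _]] [k sa] inv].
have df : differentiable_at e f x by apply: smooth_on_differentiable => //; exact: sf.
have da : differentiable_at e alpha x.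
  by apply: smooth_on_differentiable => //; have [h _] := sa; exact: h.
have aa y : alpha y *m alpha y = alpha y by have [_ /(_ y)[]] := sa.
have ah y : (alpha y) ^t* = alpha y by have [_ /(_ y)[]] := sa.
have idem := wirtinger_idem _ ce ex da aa.
have inv1 : alpha x *m (Az e f x *m alpha x) = Az e f x *m alpha x.
  apply: eq_cols => j; have [_ [_ /(_ x ex)]] := inv e _ Ae (section_on_col j Ae sa).
  by rewrite /fiber /= !colE !mulmxA.
have inv2 : alpha x *m (dzbar e alpha x + Azbar e f x *m alpha x) =
    dzbar e alpha x + Azbar e f x *m alpha x.
  apply: eq_cols => j; have [[_ /(_ x ex) h] _] := inv e _ Ae (section_on_col j Ae sa).
  have key : dzbar e (fun y => col j (alpha y)) x + Azbar e f x *m col j (alpha x) =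
      col j (dzbar e alpha x + Azbar e f x *m alpha x).
    by rewrite [in LHS]dzbarE (wirtinger_col _ e alpha x j) -dzbarE !colE mulmxDl mulmxA.
  move: h; rewrite /fiber /= key => h.
  by rewrite [LHS]colE -mulmxA -colE.
split; first by rewrite -mulmxA mulmxBl mul1mx inv1 subrr.
have := congr1 (fun X : 'M[R[i]]_n => X ^t*) inv2.
rewrite !adjM adjD adjM ah (dzbar_adj da).
rewrite (Azbar_adj ce ex df uf) (_ : (fun y => (alpha y) ^t*) = alpha); last exact/funext.
move=> h; have : (dz e alpha x + alpha x *m - Az e f x) *m (1%:M - alpha x) = 0.
  by rewrite mulmxBr mulmx1 h subrr.
rewrite mulmxDl mulmxN mulNmx => /eqP; rewrite subr_eq0 => /eqP <-.
by rewrite mulmxBr mulmx1 dzE -{1}idem addrC addKr.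
Qed.

(* X(t) = \sum_k X_k t^k, t the inverse of the spectral parameter, is an extended
   solution.  It is normalised by X_0 = 0, so that the truncation 0.-1 = 0
   gives the right equation for k = 0. *)
Definition extended_solution e f (K : nat) (X : nat -> M -> 'M[R[i]]_n) : Prop :=
  [/\ forall x, X 0%N x = 0, forall k x, (K <= k)%N -> X k x = 0,
      forall x, \sum_(k < K) X k x \in unitmx &
      forall x k, dom e x -> differentiable_at e (X k) x /\
        dz e (X k) x = (X k x - X k.-1 x) *m Az e f x].

(** Induction on the unitons: a constant u has A_z = 0 and solution t u, and adding the uniton P
    multiplies X(t) on the right by t P + (1 - P). *)
Lemma finite_uniton_number_solution (A : set (chart R M)) e f :
  A e -> is_chart e -> finite_uniton_number A f ->
  (forall x, dom e x -> nilpotent_mx (Az e f x)) /\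
  exists K X, extended_solution e f K X.
Proof.
move=> Ae ce; elim=> [u uu|{}f alpha _ [nil [K [X [X0 XK XU XD]]]] ua].
  have Az0 x : Az e (fun=> u) x = 0.
    by rewrite /Az dzE wirtinger_cst mulmx0 scaler0.
  split=> [x _|]; first by exists 1%N; rewrite Az0 expr1.
  (* The constant sits in degree 1 because degree 0 is reserved for the normalisation. *)
  exists 2%N, (fun k _ => if k == 1%N then u else 0); split => //.
  - by move=> [|[|k]].
  - by move=> x; rewrite !big_ord_recl big_ord0 /= add0r addr0 unitarymx_unit.
  - move=> x k _; split; first exact: differentiable_cst.
    by rewrite dzE wirtinger_cst Az0 mulmx0.
have [[uf [sf _]] [r [sa oa]] _] := ua.
have aa y : alpha y *m alpha y = alpha y by have [] := oa y.
have df x : dom e x -> differentiable_at e f x.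
  by move=> ex; apply: smooth_on_differentiable => //; exact: sf.
have da x : dom e x -> differentiable_at e alpha x.
  by move=> ex; apply: smooth_on_differentiable => //; exact: sa.
have AzE x : dom e x -> Az e (fun y => f y *m reflection alpha y) x =
    alpha x *m Az e f x *m alpha x +
    (1%:M - alpha x) *m Az e f x *m (1%:M - alpha x) - (1%:M - alpha x) *m dz e alpha x.
  move=> ex; have [QaP PaQ] := uniton_invariance Ae ce ex ua.
  rewrite (Az_mul_reflection ce ex (df x ex) (da x ex) (unitarymx_unit (uf x)) (aa x)).
  exact: uniton_block.
split=> [x ex|].
  have [QaP _] := uniton_invariance Ae ce ex ua.
  rewrite (AzE x ex); apply: nilpotent_uniton (aa x) _ QaP (nil x ex).
  by rewrite dzE; exact: (wirtinger_idem _ ce ex (da x ex) aa).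
exists K.+1, (fun k x => X k.-1 x *m alpha x + X k x *m (1%:M - alpha x)); split.
- by move=> x; rewrite X0 !mul0mx addr0.
- by move=> [|k] x //= hk; rewrite !XK ?mul0mx ?addr0 //; apply: leqW.
(* At t = 1 the new factor is 1, so X(1) is unchanged; the shift of indices is harmless as X_0 = X_K
   = 0. *)
- move=> x; rewrite big_ord_recl /= X0 !mul0mx !add0r big_split /= -!mulmx_suml.
  have -> : \sum_(k < K) X k.+1 x = \sum_(k < K) X k x.
    have := @big_ord_recl _ 0 +%R K (fun k => X k x).
    by rewrite big_ord_recr /= X0 XK // addr0 add0r => ->.
  by rewrite -mulmxDr addrC subrK mulmx1.
- move=> x k ex; have [_ _ pz _ _] := ce.
  have [dX EX] := XD x k ex; have [dY EY] := XD x k.-1 ex.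
  have dQ : differentiable_at e (fun y => 1%:M - alpha y) x.
    by apply: differentiableB => //; [exact: differentiable_cst|exact: da].
  have dYP := differentiableM (pz x ex) dY (da x ex).
  have dXQ := differentiableM (pz x ex) dX dQ.
  split; first exact: differentiableD.
  rewrite dzE (wirtingerD _ dYP dXQ) (wirtingerM _ (pz x ex) dY (da x ex)).
  rewrite (wirtingerM _ (pz x ex) dX dQ).
  rewrite (wirtingerB _ (differentiable_cst e x 1%:M) (da x ex)) wirtinger_cst sub0r.
  rewrite -!dzE EX EY (AzE x ex).
  have [QaP PaQ] := uniton_invariance Ae ce ex ua.
  exact: (uniton_gauge _ _ _ (aa x) QaP PaQ).
Qed.
End Unitons.

(** * Second fundamental forms as matrices *)

Section SecondForm.
Variables (R : realType) (M : topologicalType) (n : nat).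
Implicit Types (e : chart R M) (x : M) (A : set (chart R M)).

(** The second form is the matrix (d phi) phi. Its columns arise from the sections given by the
    columns of phi; conversely, differentiating s = phi s shows that the normal part of ds is (d
    phi) phi applied to the value s x. *)
Lemma second_form_factor c A e k l (phi psi : M -> 'M[R[i]]_n) x :
  A e -> is_chart e -> dom e x -> subbundle k A phi -> orthoproj l (psi x) ->
  fiber psi x = second_form_image (@wirtinger R M n 1 c) e phi x ->
  psi x *m (wirtinger c e phi x *m phi x) = wirtinger c e phi x *m phi x /\
  exists W : 'M[R[i]]_n, psi x = wirtinger c e phi x *m phi x *m W.
Proof.
move=> Ae ce ex sphi [_ ss _] fib; have [sm op] := sphi.
have dphi : differentiable_at e phi x.
  by apply: smooth_on_differentiable => //; exact: sm.
have pp y : phi y *m phi y = phi y by have [] := op y.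
have idem := wirtinger_idem c ce ex dphi pp.
have normal : (1%:M - phi x) *m wirtinger c e phi x = wirtinger c e phi x *m phi x.
  by rewrite mulmxBl mul1mx -{1}idem addrK.
split.
  apply: eq_cols => j.
  have : second_form_image (@wirtinger R M n 1 c) e phi x
      (col j (wirtinger c e phi x *m phi x)).
    exists (fun y => col j (phi y)); first exact: section_on_col Ae sphi.
    by rewrite wirtinger_col -normal !colE mulmxA.
  by rewrite -fib /fiber /= !colE !mulmxA.
apply: factor_of_cols => j.
have : fiber psi x (col j (psi x)) by rewrite /fiber /= !colE mulmxA ss.
rewrite fib => -[s [sms fs] ->]; exists (s x).
have ds : differentiable_at e s x by exact: smooth_on_differentiable.
have [od _ pz _ _] := ce.
have dps := differentiableM (pz x ex) dphi ds.
have eqs : \forall y \near x, phi y *m s y = s y.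
  by apply: filterS (open_nbhs_nbhs (conj od ex)) => y ey; exact: fs.
have dsE := wirtinger_near c ce ex dps eqs.
have [_ QP _ _] := complement_idem (pp x).
by rewrite -dsE (wirtingerM _ (pz x ex) dphi ds) mulmxDr !mulmxA normal QP mul0mx addr0.
Qed.

(** As psi has the same rank k as phi, passing from phi to (d phi) phi loses no rank. *)
Lemma second_form_rank c A e k (phi psi : M -> 'M[R[i]]_n) x :
  A e -> is_chart e -> dom e x -> subbundle k A phi -> orthoproj k (psi x) ->
  fiber psi x = second_form_image (@wirtinger R M n 1 c) e phi x ->
  exists V : 'M[R[i]]_n, phi x = V *m (wirtinger c e phi x *m phi x).
Proof.
move=> Ae ce ex sphi opsi fib.
have [_ [W SW]] := second_form_factor Ae ce ex sphi opsi fib.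
apply: left_factor; have [_ /(_ x)[_ _ ->]] := sphi.
have [_ _ <-] := opsi; rewrite SW; exact: mxrankM_maxl.
Qed.

(** An open chart image in the plane has points other than [zcoord e x] arbitrarily near it, and
    removing x from an open set leaves it open since points are closed. *)
Lemma dnbhs_open_point e x (Q : M -> Prop) :
  hausdorff_space M -> is_chart e -> dom e x ->
  (\forall y \near x^', Q y) -> exists y : M, \forall z \near y, Q z.
Proof.
move=> hM [_ oz pz _ cp] ex Qx.
have [V [oV Vx] VQ] : exists2 V, open_nbhs x V & V `<=` (fun y => y != x -> Q y).
  have : nbhs x (fun y => y != x -> Q y) := Qx.
  by rewrite nbhsE.
have zi : zcoord e x \in zcoord_image e by apply/mem_set; exists x.
have [z [zx [Vz [y ey zy]]]] : exists z, z != zcoord e x /\ V (param e z) /\ zcoord_image e z.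
  apply: (@filter_ex _ ((zcoord e x)^')).
  have cV : \forall z \near zcoord e x, V (param e z).
    by apply: cp => //; rewrite pz //; apply: open_nbhs_nbhs.
  have cI : \forall z \near zcoord e x, zcoord_image e z.
    by apply: open_nbhs_nbhs; split => //; apply/set_mem.
  suff : nbhs (zcoord e x) (fun z => z != zcoord e x ->
      z != zcoord e x /\ V (param e z) /\ zcoord_image e z) by [].
  by apply: filterS2 cV cI.
have yx : y != x by apply: contraNneq zx => <-; rewrite zy.
exists y; move: Vz; rewrite -zy pz // => Vy.
have nV : nbhs y V by apply: open_nbhs_nbhs.
have nx : nbhs y (~` [set x]).
  apply: open_nbhs_nbhs; split; last by move=> /= h; rewrite h eqxx in yx.
  apply: closed_openC; apply: accessible_closed_set1; exact: hausdorff_accessible.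
by apply: filterS2 nV nx => w Vw wx; apply: VQ => //; apply/eqP.
Qed.

End SecondForm.


(** * Contradiction from an irreducible first Gauss bundle in rank 2 and dimension 5 *)

Lemma subbundle_rank (R : realType) (M : topologicalType) n k l
    (A : set (chart R M)) (f : M -> 'M[R[i]]_n) (x : M) :
  subbundle k A f -> subbundle l A f -> k = l.
Proof. by move=> [_ /(_ x)[_ _ <-]] [_ /(_ x)[_ _ <-]]. Qed.

Theorem proposition2p8 (R : realType) (M : topologicalType)
    (A : set (chart R M)) (phi : M -> 'M[R[i]]_5) :
  connected_riemann_surface A ->
  harmonic_grassmann 2 A phi ->
  finite_uniton_number A (reflection phi) ->
  irreducible' A phi ->
  irreducible'' A phi ->
  forall (k : nat) (psi : M -> 'M[R[i]]_5),
    is_gauss' k A phi psi -> reducible' A psi.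
Proof.
move=> [hM [[x0 _] _] charts cover _] [sphi _] fin [k0 [psi0 [sphi0 [spsi0 g0]]]].
move=> [k1 [psi1 [sphi1 [spsi1 g1]]]] k psi [spsi g] [k2 [psi2 [spsi' [spsi2 g2]]]].
(* Irreducibility hides its rank in an existential; comparison at x0 gives [psi0] and [psi1] rank 2,
   and [psi2], from the assumption to be refuted, the rank k of psi. *)
rewrite (subbundle_rank x0 sphi0 sphi) in spsi0.
rewrite (subbundle_rank x0 sphi1 sphi) in spsi1.
rewrite (subbundle_rank x0 spsi' spsi) in spsi2.
have [e Ae ex0] := cover x0; have ce := charts e Ae.
have [od _ pz _ _] := ce.
pose Q y := [/\ dom e y, fiber psi y = second_form_image (@dz R M 5 1) e phi y,
  fiber psi0 y = second_form_image (@dz R M 5 1) e phi y,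
  fiber psi1 y = second_form_image (@dzbar R M 5 1) e phi y &
  fiber psi2 y = second_form_image (@dz R M 5 1) e psi y].
have [y Qy] : exists y : M, \forall z \near y, Q z.
  apply: (dnbhs_open_point hM ce ex0).
  have nd : \forall z \near x0^', dom e z.
    suff : nbhs x0 (fun z => z != x0 -> dom e z) by [].
    by apply: filterS (open_nbhs_nbhs (conj od ex0)) => z.
  have h := g e x0 Ae ex0; have h0 := g0 e x0 Ae ex0.
  have h1 := g1 e x0 Ae ex0; have h2 := g2 e x0 Ae ex0.
  apply: filterS (filterI nd (filterI h (filterI h0 (filterI h1 h2)))).
  by move=> z [? [? [? []]]].
have idem l (f : M -> 'M[R[i]]_5) : subbundle l A f -> forall z, f z *m f z = f z.
  by move=> [_ of_] z; have [] := of_ z.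
have herm l (f : M -> 'M[R[i]]_5) : subbundle l A f -> forall z, (f z) ^t* = f z.
  by move=> [_ of_] z; have [] := of_ z.
have diffb l (f : M -> 'M[R[i]]_5) : subbundle l A f ->
    forall z, dom e z -> differentiable_at e f z.
  by move=> [sf _] z ez; apply: smooth_on_differentiable => //; exact: sf.
have PP := idem _ _ sphi; have SS := idem _ _ spsi.
have Ph := herm _ _ sphi; have Sh := herm _ _ spsi.
have dphi := diffb _ _ sphi; have dpsi := diffb _ _ spsi.
have ddP z (ez : dom e z) : dz e phi z *m phi z + phi z *m dz e phi z = dz e phi z.
  by rewrite dzE; exact: (wirtinger_idem _ ce ez (dphi z ez) PP).
have ddS z (ez : dom e z) : dz e psi z *m psi z + psi z *m dz e psi z = dz e psi z.
  by rewrite dzE; exact: (wirtinger_idem _ ce ez (dpsi z ez) SS).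
have A'phi z : Q z -> psi z *m (dz e phi z *m phi z) = dz e phi z *m phi z /\
    exists W : 'M[R[i]]_5, psi z = dz e phi z *m phi z *m W.
  move=> [ez fz _ _ _]; rewrite !dzE in fz *.
  by apply: (second_form_factor Ae ce ez sphi _ fz); have [_] := spsi; apply.
(* Here [psi0] serves instead of psi, whose rank k is not yet tied to 2. *)
have A'phi_inj z : Q z -> exists V : 'M[R[i]]_5, phi z = V *m (dz e phi z *m phi z).
  move=> [ez _ fz _ _]; rewrite !dzE in fz *.
  by apply: (second_form_rank Ae ce ez sphi _ fz); have [_] := spsi0; apply.
have A'psi_inj z : Q z -> exists V : 'M[R[i]]_5, psi z = V *m (dz e psi z *m psi z).
  move=> [ez _ _ _ fz]; rewrite !dzE in fz *.
  by apply: (second_form_rank Ae ce ez spsi _ fz); have [_] := spsi2; apply.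
(* The adjoint of injectivity of A''_phi: the component of A_z from phi^perp to phi is onto. *)
have A''phi_inj z : Q z -> exists V : 'M[R[i]]_5, phi z = phi z *m dz e phi z *m V.
  move=> [ez _ _ fz _].
  have [V /(congr1 (fun X : 'M[R[i]]_5 => X ^t*))] : exists V : 'M[R[i]]_5,
      phi z = V *m (dzbar e phi z *m phi z).
    rewrite !dzbarE in fz *.
    by apply: (second_form_rank Ae ce ez sphi _ fz); have [_] := spsi1; apply.
  rewrite !adjM Ph (dzbar_adj (dphi z ez)).
  by rewrite (_ : (fun y => (phi y) ^t*) = phi); [exists (V ^t*)|exact/funext].
have PS z : Q z -> phi z *m psi z = 0.
  move=> Qz; have [ez _ _ _ _] := Qz; have [_ [W ->]] := A'phi z Qz.
  by rewrite !mulmxA (idem_derivative (PP z) (ddP z ez)) mul0mx.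
have rank5 z : Q z -> (5 <= (\rank (phi z) + \rank (psi z)).+1)%N.
  move=> Qz; have [V e1] := A'phi_inj z Qz; have [e2 _] := A'phi z Qz.
  have rP : \rank (phi z) = 2 by have [_ /(_ z)[]] := sphi.
  have : (\rank (phi z) <= \rank (psi z))%N.
    by rewrite {1}e1 -e2 (leq_trans (mxrankM_maxr _ _)) // mxrankM_maxl.
  by rewrite rP; lia.
have [nil [K [X [_ XK XU XD]]]] := finite_uniton_number_solution Ae ce fin.
have aE z (ez : dom e z) : Az e (reflection phi) z =
    phi z *m dz e phi z - dz e phi z *m phi z.
  exact: (Az_reflection ce ez (dphi z ez) PP).
have leibniz0 (f h : M -> 'M[R[i]]_5) z : dom e z -> differentiable_at e f z ->
    differentiable_at e h z -> (\forall w \near z, f w *m h w = 0) ->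
    dz e f z *m h z + f z *m dz e h z = 0.
  move=> ez df dh fh; rewrite !dzE -(wirtingerM _ (pz z ez) df dh).
  have dfh := differentiableM (pz z ez) df dh.
  by rewrite (wirtinger_near _ ce ez dfh fh) wirtinger_cst.
(* Descending induction on the degree l, with m bounding K - l. The interior of Q is used because
   vanishing has to be differentiated. *)
have vanish m l z : (K <= l + m)%N -> Q° z -> X l z = 0.
  elim: m l z => [|m IH] l z lm Uz; first by apply: XK; rewrite -(addn0 l).
  (* X_(l+1) vanishes near w, so its equation reduces to 0 = - X_l A_z. *)
  have Xa w : Q° w -> X l w *m Az e (reflection phi) w = 0.
    move=> Uw; have [ew _ _ _ _] := nbhs_singleton Uw.
    have [dX] := XD w l.+1 ew.
    have z0 v : Q° v -> X l.+1 v = 0 by move=> Uv; apply: IH => //; rewrite addSnnS.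
    have near0 : \forall v \near w, X l.+1 v = 0.
      by apply: filterS z0 _; exact: nbhs_interior.
    rewrite dzE (wirtinger_near _ ce ew dX near0) wirtinger_cst /= z0 // sub0r mulNmx.
    by move=> /eqP; rewrite eq_sym oppr_eq0 => /eqP.
  have XPS w : Q° w -> X l w *m phi w = 0 /\ X l w *m psi w = 0.
    move=> Uw; have Qw := nbhs_singleton Uw; have [ew _ _ _ _] := Qw.
    have [_ [W SE]] := A'phi w Qw; have [V PE] := A''phi_inj w Qw.
    exact: (annihilator_images (PP w) (ddP w ew) (aE w ew) SE PE (Xa w Uw)).
  have Qz := nbhs_singleton Uz; have [ez _ _ _ _] := Qz.
  have [SdP [W SE]] := A'phi z Qz.
  have [V1 P1] := A'phi_inj z Qz; have [V3 S1] := A'psi_inj z Qz.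
  have [dX XE] := XD z l ez; have [XP XS] := XPS z Uz.
  have nearQ : \forall w \near z, Q° w by exact: nbhs_interior.
  have dPS : dz e phi z *m psi z + phi z *m dz e psi z = 0.
    apply: leibniz0 => //; [exact: dphi|exact: dpsi|].
    by apply: filterS Uz => w; exact: PS.
  have dXS : dz e (X l) z *m psi z + X l z *m dz e psi z = 0.
    apply: leibniz0 => //; first exact: dpsi.
    by apply: filterS nearQ => w /XPS [].
  have SP : psi z *m phi z = 0.
    have := congr1 (fun Y : 'M[R[i]]_5 => Y ^t*) (PS z Qz).
    by rewrite adjM Ph Sh => ->; rewrite raddf0 map_mx0.
  have P0 : phi z != 0.
    by rewrite -mxrank_eq0; have [_ /(_ z)[_ _ ->]] := sphi.
  exact: (top_coefficient_eq0 P0 (PP z) (SS z) SP (rank5 z Qz) (ddP z ez) (ddS z ez)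
    dPS SdP SE P1 S1 (aE z ez) (nil z ez) XP XS dXS XE).
(* All coefficients vanish at y, so the invertible X(1) would be the zero matrix. *)
have := XU y; rewrite big1 => [|l _]; last by apply: (vanish K); rewrite ?leq_addl.
by rewrite unitmxE det0 unitr0.
Qed.
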